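(* Let $G$ be a connected graph with $m$ edges. The transitive prune procedure applied to $G$ terminates and outputs a partition $\mathcal{P}$ of $E(G)$ such that: (i) each class of $\mathcal{P}$ is a clique of the $\varphi$-graph $\varphi(G)$; (ii) each class is a matching of $G$; (iii) if $G$ is a partial cube, $\mathcal{P}$ equals the set of $\theta$-classes of $G$; (iv) $|\mathcal{P}|\leq m$.
   Context: Graphs are finite, simple, connected and undirected; $d=d_G$ is the shortest-path distance. For edges $e=\{u,v\}$, $f=\{x,y\}$ of $G$: $e\mathrel{\varphi}f$ iff $d(u,x)=d(v,y)$ and $d(u,y)=d(v,x)$; $e\mathrel{\theta}f$ iff $d(u,x)+d(v,y)\neq d(u,y)+d(v,x)$. The $\varphi$-graph $\varphi(G)$ has vertex set $E(G)$, two elements being adjacent iff they are distinct and $\varphi$-related. A partial cube is a graph admitting an isometric embedding into a hypercube $Q_k$ (on a partial cube $\theta$ is an equivalence relation). The transitive prune: start with $H=\varphi(G)$ and $\mathcal{P}=\emptyset$; while $H$ has vertices, take a largest connected component $C$ of $H$; if $C$ is a clique, add the vertex set of $C$ to $\mathcal{P}$ as a class and delete it from $H$; otherwise, extract a clique $K$ of $H[C]$ (nonempty; a maximum clique when the search is exact, or one found by a greedy approximation for large components), add $K$ to $\mathcal{P}$ as a class, and delete it from $H$. Isolated vertices of $H$ become singleton classes. *)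

(* Defs.v *)
From Stdlib Require Relation_Operators.
From mathcomp Require Import all_boot.

Set Implicit Arguments.
Unset Strict Implicit.
Unset Printing Implicit Defensive.

Section GeneralGraphs.
Variables (V : finType) (r : rel V).

Definition has_walk (n : nat) (x y : V) : bool :=
  [exists p : n.-tuple V, path r x p && (last x p == y)].

(* A shortest walk has fewer than #|V| edges; the value is #|V| when x and y
   lie in different components. *)
Definition gdist (x y : V) : nat :=
  find (fun n => has_walk n x y) (iota 0 #|V|).

Definition is_clique (K : {set V}) : bool :=
  [forall a in K, forall b in K, (a != b) ==> r a b].

Definition induced (H : {set V}) : rel V :=
  [rel a b | [&& a \in H, b \in H & r a b]].

Definition components (H : {set V}) : {set {set V}} :=
  equivalence_partition (connect (induced H)) H.

Definition largest_component (H C : {set V}) : Prop :=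
  C \in components H /\ {in components H, forall D : {set V}, #|D| <= #|C|}.

End GeneralGraphs.

Definition hypercube (k : nat) : rel {ffun 'I_k -> bool} :=
  fun x y => #|[set i | x i != y i]| == 1.

Section EdgeRelations.
Variables (T : finType) (e : rel T).

Definition partial_cube : Prop :=
  exists (k : nat) (f : T -> {ffun 'I_k -> bool}),
    forall x y, gdist (@hypercube k) (f x) (f y) = gdist e x y.

Definition edge_set : {set {set T}} :=
  [set A : {set T} | [exists u, exists v, (A == [set u; v]) && e u v]].

Definition is_matching (M : {set {set T}}) : bool :=
  (M \subset edge_set) && trivIset M.

Local Notation d := (gdist e).

(* The conditions below are invariant under exchanging the endpoints of either
   edge, so existence of a suitable labelling of the endpoints is the same as
   the condition for every labelling. They are meant for A, B in edge_set. *)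
Definition phi_rel : rel {set T} := [rel A B |
  [exists u, exists v, exists x, exists y,
    [&& A == [set u; v], B == [set x; y], d u x == d v y & d u y == d v x]]].

Definition theta_rel : rel {set T} := [rel A B |
  [exists u, exists v, exists x, exists y,
    [&& A == [set u; v], B == [set x; y] & d u x + d v y != d u y + d v x]]].

(* Adjacency of the phi-graph, whose vertex set is edge_set. *)
Definition phi_adj : rel {set T} := [rel A B | (A != B) && phi_rel A B].

Definition theta_classes : {set {set {set T}}} :=
  equivalence_partition theta_rel edge_set.

End EdgeRelations.

Section TransitivePrune.
Variables (T : finType) (e : rel T).

(* [extract C K]: the clique search run on the subgraph of the phi-graph induced
   by C may return K. As a relation it covers exact, greedy and randomized
   searches; a search must succeed on every non-clique C, which is where the
   procedure calls it. *)
Variable extract : {set {set T}} -> {set {set T}} -> Prop.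

Definition clique_search : Prop :=
  forall C : {set {set T}}, C \subset edge_set e -> ~~ is_clique (phi_adj e) C ->
    (exists K, extract C K) /\
    (forall K, extract C K ->
       [/\ K != set0, K \subset C & is_clique (phi_adj e) K]).

(* The vertices of the current graph H (an induced subgraph of the phi-graph)
   and the classes produced so far. *)
Definition prune_state : Type := ({set {set T}} * {set {set {set T}}})%type.

Definition prune_init : prune_state := (edge_set e, set0).

(* One iteration of the loop; ties between largest components are broken
   arbitrarily. *)
Inductive prune_step : prune_state -> prune_state -> Prop :=
| prune_clique H P C :
    largest_component (phi_adj e) H C -> is_clique (phi_adj e) C ->
    prune_step (H, P) (H :\: C, C |: P)
| prune_extract H P C K :
    largest_component (phi_adj e) H C -> ~~ is_clique (phi_adj e) C ->
    extract C K ->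
    prune_step (H, P) (H :\: K, K |: P).

Definition prune_reachable : prune_state -> Prop :=
  Relation_Operators.clos_refl_trans prune_state prune_step prune_init.

(* No infinite execution, and no execution gets stuck while H has vertices. *)
Definition prune_terminates : Prop :=
  Acc (fun s' s => prune_step s s') prune_init /\
  (forall s, prune_reachable s -> s.1 != set0 -> exists s', prune_step s s').

Definition prune_output (P : {set {set {set T}}}) : Prop :=
  prune_reachable (set0, P).

End TransitivePrune.

(* Main.v *)
(** The loop removes a nonempty set of vertices at each iteration, and the
    classes produced so far always partition the removed edges into cliques of
    the phi-graph. Two distinct phi-related edges share no endpoint, because
    [d u x = 0] forces [d v y = 0]; so cliques are matchings.

    In a partial cube every edge flips a single coordinate of the hypercube, its
    direction, and both [phi_rel] and [theta_rel] on edges amount to equality of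
    directions. The components of the phi-graph are then the theta-classes, all
    of them cliques, and the loop removes them one at a time. *)

Require Import Defs.
From mathcomp Require Import all_boot.
From mathcomp Require Import zify.

Set Implicit Arguments.
Unset Strict Implicit.
Unset Printing Implicit Defensive.

(** * Shortest-path distance through walks *)

Section Distance.
Variables (V : finType) (r : rel V).

Lemma has_walkP n x y :
  reflect (exists p, [/\ size p = n, path r x p & last x p = y])
          (has_walk r n x y).
Proof.
apply: (iffP existsP) => [[p /andP[rp /eqP lp]]|[p [sp rp lp]]].
  by exists p; rewrite size_tuple.
have sp' : size p == n by apply/eqP.
by exists (Tuple sp'); rewrite /= rp lp eqxx.
Qed.

(** The bound [n < #|V|] puts [n] in the range searched by [find], so the default value is ruled
    out. *)
Lemma gdist_eq n x y :
  n < #|V| -> has_walk r n x y -> (forall m, has_walk r m x y -> n <= m) ->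
  gdist r x y = n.
Proof.
move=> ltnV wn wmin; apply/eqP; rewrite eqn_leq /gdist; apply/andP; split.
  rewrite leqNgt; apply/negP => /(before_find 0).
  by rewrite nth_iota // add0n wn.
have hasw : has (fun n => has_walk r n x y) (iota 0 #|V|).
  by apply/hasP; exists n; rewrite // mem_iota.
have := nth_find 0 hasw; rewrite nth_iota; first exact: wmin.
by move: hasw; rewrite has_find size_iota.
Qed.

Lemma has_walk0 x y : has_walk r 0 x y = (x == y).
Proof.
apply/has_walkP/eqP => [[[|z p] [] //]|->].
by exists [::].
Qed.

Lemma gdistxx x : gdist r x x = 0.
Proof. by apply: gdist_eq; rewrite ?has_walk0 //; apply/card_gt0P; exists x. Qed.

Lemma gdist0_eq x y : gdist r x y = 0 -> x = y.
Proof.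
(* The default value [#|V|] is positive, so the value 0 can only come from a walk of length 0. *)
have : 0 < #|V| by apply/card_gt0P; exists x.
rewrite /gdist; case: #|V| => //= n _; rewrite has_walk0.
by case: eqP.
Qed.

Lemma gdist_edge x y : x != y -> r x y -> gdist r x y = 1.
Proof.
move=> xy rxy; apply: gdist_eq.
- by rewrite (cardD1 x) (cardD1 y) !inE eq_sym xy.
- by apply/has_walkP; exists [:: y]; rewrite /= rxy.
- by case=> //; rewrite has_walk0 (negPf xy).
Qed.

End Distance.

(** * Hamming distance and edge directions in the hypercube *)

Section Hypercube.
Variable k : nat.
Implicit Types x y z u v : {ffun 'I_k -> bool}.

(** A sum over coordinates, so that relations between distances can be checked one coordinate at a
    time. *)
Definition hamming x y := \sum_(i < k) (x i != y i).

Lemma card_diff x y : #|[set i | x i != y i]| = hamming x y.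
Proof.
rewrite /hamming -sum1dep_card big_mkcond.
by apply: eq_bigr => i _; case: ifP.
Qed.

Lemma hamming_triangle y x z : hamming x z <= hamming x y + hamming y z.
Proof.
rewrite /hamming -big_split; apply: leq_sum => i _ /=.
by case: (x i); case: (y i); case: (z i).
Qed.

Lemma hamming0 x : hamming x x = 0.
Proof. by rewrite /hamming big1 // => i _; rewrite eqxx. Qed.

Lemma hamming_le_walk n x y : has_walk (@hypercube k) n x y -> hamming x y <= n.
Proof.
move=> /has_walkP[p [<- ]]; elim: p x => [|z p IHp] x /=.
  by move=> _ ->; rewrite hamming0.
move=> /andP[]; rewrite /hypercube card_diff => /eqP xz zp lp.
by rewrite (leq_trans (hamming_triangle z x y)) // xz add1n ltnS IHp.
Qed.

(** The walk corrects the coordinates where [x] and [y] differ one after another. *)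
Lemma hamming_walk x y : has_walk (@hypercube k) (hamming x y) x y.
Proof.
move: {2}(hamming x y) (erefl (hamming x y)) => n; elim: n x => [|n IHn] x dxy.
  rewrite dxy has_walk0; apply/eqP/ffunP => i.
  move/eqP: dxy; rewrite /hamming sum_nat_eq0 => /forallP /(_ i) /=.
  by rewrite eqb0 negbK => /eqP.
have [i xyi] : exists i, x i != y i.
  have /card_gt0P[i] : 0 < #|[set i | x i != y i]| by rewrite card_diff dxy.
  by rewrite inE; exists i.
pose z := [ffun j => if j == i then y j else x j].
have dxz : hypercube x z.
  apply/cards1P; exists i; apply/setP => j; rewrite !inE ffunE.
  by case: (eqVneq j i) => [->|_]; rewrite ?xyi ?eqxx.
have dzy : hamming z y = n.
  apply/eqP; rewrite -eqSS -dxy /hamming (bigD1 i) // [eqbRHS](bigD1 i) //=.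
  rewrite xyi ffunE !eqxx add0n add1n eqSS; apply/eqP.
  by apply: eq_bigr => j /negPf ji; rewrite ffunE ji.
have /has_walkP[p [sp pp lp]] := IHn _ dzy.
by apply/has_walkP; exists (z :: p); rewrite /= sp dzy dxy dxz.
Qed.

Lemma gdist_hypercube x y : gdist (@hypercube k) x y = hamming x y.
Proof.
apply: gdist_eq; [| exact: hamming_walk | by move=> m; exact: hamming_le_walk].
(* A Hamming distance is at most [k], and [k < 2 ^ k], the number of vertices; hence it lies in the
   range searched by [gdist]. *)
rewrite card_ffun card_bool card_ord -card_diff.
rewrite (leq_ltn_trans (max_card _)) // card_ord.
exact: ltn_expl.
Qed.

Lemma hamming_phi u v x y i j :
    (forall l, (u l != v l) = (l == i)) -> (forall l, (x l != y l) = (l == j)) ->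
  (hamming u x == hamming v y) && (hamming u y == hamming v x) = (i == j).
Proof.
move=> uv xy; apply/andP/eqP => [[/eqP e1 /eqP e2]|ij].
  (* If i != j, the total distances to {x, y} from u and from v get equal
     contributions from every coordinate but i, where they get 0 and 2. *)
  apply/eqP; apply/negPn/negP => ij.
  have : hamming u x + hamming u y = hamming v y + hamming v x by rewrite e1 e2.
  rewrite /hamming -!big_split /= (bigD1 i) // [RHS](bigD1 i) //=.
  rewrite (eq_bigr (fun l => (v l != y l) + (v l != x l))).
    move: (uv i) (xy i); rewrite eqxx (negPf ij).
    by case: (u i); case: (v i); case: (x i); case: (y i) => //=; lia.
  move=> l /negPf li; move: (uv l); rewrite li => /negbFE /eqP ->.
  by rewrite addnC.
(* With a common direction, at each coordinate either both edges are constant or both flip; either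
   way the two distances get equal contributions. *)
rewrite -ij in xy.
split; apply/eqP; apply: eq_bigr => l _; move: (uv l) (xy l) => <-;
  by case: (u l); case: (v l); case: (x l); case: (y l).
Qed.

(** If [i != j], at every coordinate one of the two edges is constant, so both sums get the same
    contribution there. If [i = j], the sums agree outside [i], where one gets 0 and the other 2. *)
Lemma hamming_theta u v x y i j :
    (forall l, (u l != v l) = (l == i)) -> (forall l, (x l != y l) = (l == j)) ->
  (hamming u x + hamming v y != hamming u y + hamming v x) = (i == j).
Proof.
move=> uv xy; case: (eqVneq i j) => ij; last first.
  apply/eqP; rewrite /hamming -!big_split /=; apply: eq_bigr => l _.
  have : ~~ ((u l != v l) && (x l != y l)).
    by rewrite uv xy; apply: contra ij => /andP[/eqP <- /eqP <-].
  by case: (u l); case: (v l); case: (x l); case: (y l).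
rewrite -ij in xy.
rewrite /hamming -!big_split /= (bigD1 i) // [X in _ != X](bigD1 i) //=.
rewrite (eq_bigr (fun l => (u l != y l) + (v l != x l))); last first.
  move=> l /negPf li; move: (uv l) (xy l); rewrite li.
  by move=> /negbFE /eqP -> /negbFE /eqP ->.
rewrite eqn_add2r; move: (uv i) (xy i); rewrite eqxx.
by case: (u i); case: (v i); case: (x i); case: (y i).
Qed.

End Hypercube.

(** * Edges, cliques as matchings, and directions in a partial cube *)

Section Edges.
Variables (T : finType) (e : rel T).
Hypotheses (e_sym : symmetric e) (e_irr : irreflexive e).

Lemma edge_setP (A : {set T}) :
  reflect (exists u v, A = [set u; v] /\ e u v) (A \in edge_set e).
Proof.
rewrite inE; apply: (iffP existsP) => [[u /existsP[v /andP[/eqP ? ?]]]|].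
  by exists u, v.
by move=> [u [v [-> euv]]]; exists u; apply/existsP; exists v; rewrite eqxx.
Qed.

Lemma edge_neq u v : e u v -> u != v.
Proof. by apply: contraTneq => ->; rewrite e_irr. Qed.

Lemma edge_set2 u v : ([set u; v] \in edge_set e) = e u v.
Proof.
apply/edge_setP/idP => [[x [y [uvxy exy]]]|]; last by exists u, v.
(* If [u = v], the set would be a singleton, whereas [[set x; y]] has two elements. *)
have uv : u != v.
  by have := cards2 x y; rewrite (edge_neq exy) -uvxy cards2; case: eqP.
have : u \in [set x; y] by rewrite -uvxy set21.
have : v \in [set x; y] by rewrite -uvxy set22.
rewrite !inE; move: uv => /[swap] /orP[] /eqP -> /[swap] /orP[] /eqP ->;
  by rewrite ?eqxx // e_sym.
Qed.

Lemma phi_meet_eq (A B : {set T}) x :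
  phi_rel e A B -> x \in A -> x \in B -> A = B.
Proof.
move=> /existsP[u /existsP[v /existsP[z /existsP[y]]]].
case/and4P => /eqP -> /eqP -> /eqP d1 /eqP d2.
rewrite !inE => /orP[] /eqP -> /orP[] /eqP E; subst.
- by move/esym: d1; rewrite gdistxx => /gdist0_eq ->.
- by move/esym: d2; rewrite gdistxx => /gdist0_eq ->; rewrite setUC.
- by move: d2; rewrite gdistxx => /gdist0_eq ->; rewrite setUC.
- by move: d1; rewrite gdistxx => /gdist0_eq ->.
Qed.

Lemma clique_matching (M : {set {set T}}) :
  M \subset edge_set e -> is_clique (phi_adj e) M -> is_matching e M.
Proof.
move=> ME cM; rewrite /is_matching ME; apply/trivIsetP => A B AM BM AB.
move/forall_inP: cM => /(_ _ AM) /forall_inP /(_ _ BM).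
rewrite AB /= => /andP[_ phiAB].
rewrite -setI_eq0; apply/set0Pn => -[x]; rewrite inE => /andP[xA xB].
by rewrite (phi_meet_eq phiAB xA xB) eqxx in AB.
Qed.

(** This isolates the hypercube: the analysis of the loop only uses that both relations compare one
    invariant of edges. *)
Lemma partial_cube_direction : partial_cube e ->
  exists (D : finType) (dir : {set T} -> D),
    {in edge_set e &, forall A B, phi_rel e A B = (dir A == dir B)} /\
    {in edge_set e &, forall A B, theta_rel e A B = (dir A == dir B)}.
Proof.
move=> [k [f f_iso]].
have fE x y : gdist e x y = hamming (f x) (f y) by rewrite -gdist_hypercube f_iso.
(* The coordinates on which members of [A] differ: this avoids choosing endpoints. *)
pose dir (A : {set T}) := [set i | [exists u in A, exists v in A, f u i != f v i]].
(* The embedding sends adjacent vertices to Hamming distance 1, so [dir] of an edge is a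
   singleton. *)
have dirE u v : e u v ->
    exists2 i, dir [set u; v] = [set i] & forall l, (f u l != f v l) = (l == i).
  move=> euv; have /eqP := fE u v.
  rewrite (gdist_edge (edge_neq euv) euv) eq_sym -card_diff => /cards1P[i fi].
  have fl l : (f u l != f v l) = (l == i) by move/setP/(_ l): fi; rewrite !inE.
  exists i => //; apply/setP => l; rewrite !inE -fl.
  apply/exists_inP/idP => [[x + /exists_inP[y]]|fuv].
    rewrite !inE => /orP[] /eqP -> /orP[] /eqP -> //; rewrite ?eqxx //.
    by rewrite eq_sym.
  by exists u; rewrite ?set21 //; apply/exists_inP; exists v; rewrite ?set22.
have set1_eq (i j : 'I_k) : ([set i] == [set j]) = (i == j).
  by apply/eqP/eqP => [/set1_inj|->].
exists {set 'I_k}, dir; split=> A B EA EB.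
- apply/idP/idP.
    move=> /existsP[u /existsP[v /existsP[x /existsP[y]]]].
    case/and4P=> /eqP AE /eqP BE; move: EA EB; rewrite AE BE !edge_set2.
    move=> /dirE[i -> fi] /dirE[j -> fj]; rewrite set1_eq !fE => d1 d2.
    by rewrite -(hamming_phi fi fj) d1 d2.
  move/edge_setP: EA => [u [v [-> /dirE[i -> fi]]]].
  move/edge_setP: EB => [x [y [-> /dirE[j -> fj]]]].
  rewrite set1_eq -(hamming_phi fi fj) -!fE => d12.
  apply/existsP; exists u; apply/existsP; exists v.
  by apply/existsP; exists x; apply/existsP; exists y; rewrite !eqxx.
- apply/idP/idP.
    move=> /existsP[u /existsP[v /existsP[x /existsP[y]]]].
    case/and3P=> /eqP AE /eqP BE; move: EA EB; rewrite AE BE !edge_set2.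
    move=> /dirE[i -> fi] /dirE[j -> fj]; rewrite set1_eq !fE => d12.
    by rewrite -(hamming_theta fi fj).
  move/edge_setP: EA => [u [v [-> /dirE[i -> fi]]]].
  move/edge_setP: EB => [x [y [-> /dirE[j -> fj]]]].
  rewrite set1_eq -(hamming_theta fi fj) -!fE => d12.
  apply/existsP; exists u; apply/existsP; exists v.
  by apply/existsP; exists x; apply/existsP; exists y; rewrite !eqxx.
Qed.

End Edges.

(** * Partitions and components *)

Section Partitions.
Variable V : finType.
Implicit Types (P Q : {set {set V}}) (H C D : {set V}).

(** The new block lies in [H], while the blocks of [P] lie outside it. With [H] the remaining edges,
    this is the effect of one iteration. *)
Lemma partition_setU1 P C D H :
  partition P (D :\: H) -> C != set0 -> C \subset H -> H \subset D ->
  partition (C |: P) (D :\: (H :\: C)).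
Proof.
move=> partP C0 CH HD.
have disjC A : A \in P -> [disjoint C & A].
  move=> PA; apply: disjointWl CH _; rewrite disjoint_sym.
  apply: disjointWl (_ : A \subset D :\: H) _.
    by rewrite -(cover_partition partP) (bigcup_max A).
  by rewrite -setI_eq0 setDE -setIA (setIC _ H) setICr setI0.
have CP : C \notin P.
  apply/negP => /disjC; rewrite -setI_eq0 setIid; exact/negP.
have trivP := partition_trivIset partP.
have P0 : set0 \notin P by case/and3P: partP.
apply/and3P; split.
- rewrite /cover big_setU1 //= -/(cover P) (cover_partition partP).
  apply/eqP/setP => x; rewrite !inE.
  have := subsetP CH x; have := subsetP HD x.
  by case: (x \in C); case: (x \in H); case: (x \in D) => // a b;
     (discriminate (a isT) || discriminate (b isT) || done).
- apply/trivIsetP => A B; rewrite !inE.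
  case/predU1P=> [->|PA] /predU1P[->|PB]; rewrite ?eqxx // => AB.
  + exact: disjC.
  + by rewrite disjoint_sym disjC.
  + by move/trivIsetP: trivP; apply.
- by rewrite !inE negb_or eq_sym C0.
Qed.

(** Each block of [Q] meets some block of [P]; that one is also a block of [Q], so the two
    coincide. *)
Lemma partition_sub_eq P Q D :
  partition P D -> partition Q D -> P \subset Q -> P = Q.
Proof.
move=> partP partQ PQ; apply/eqP; rewrite eqEsubset PQ; apply/subsetP => B QB.
have /set0Pn[x xB] := partition_neq0 partQ QB.
have : x \in cover P.
  rewrite (cover_partition partP) -(cover_partition partQ).
  by apply/bigcupP; exists B.
case/bigcupP => B' PB' xB'.
have QB' := subsetP PQ _ PB'; have trivQ := partition_trivIset partQ.
by rewrite -(def_pblock trivQ QB xB) (def_pblock trivQ QB' xB').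
Qed.

Lemma card_partition_le P D : partition P D -> #|P| <= #|D|.
Proof.
move=> partP; rewrite (card_partition partP) -sum1_card.
by apply: leq_sum => B /(partition_neq0 partP); rewrite card_gt0.
Qed.

Lemma largest_component_exists (r : rel V) H :
  H != set0 -> exists C, largest_component r H C.
Proof.
case/set0Pn => x xH.
have cC : [set y in H | connect (induced r H) x y] \in components r H.
  by apply/imsetP; exists x.
by case: (arg_maxnP (fun C : {set V} => #|C|) cC) => C; exists C.
Qed.

Lemma componentP (r : rel V) H C :
  C \in components r H ->
  [/\ C != set0, C \subset H &
      exists2 x, x \in H & C = [set y in H | connect (induced r H) x y]].
Proof.
case/imsetP => x xH ->; split; last by exists x.
- by apply/set0Pn; exists x; rewrite inE xH connect0.
- by apply/subsetP => y; rewrite inE => /andP[].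
Qed.

End Partitions.

(** * Executions of the prune: termination, invariant, and partial cubes *)

Section Prune.
Variables (T : finType) (e : rel T).
Variable extract : {set {set T}} -> {set {set T}} -> Prop.
Hypothesis extractP : clique_search e extract.
Hypotheses (e_sym : symmetric e) (e_irr : irreflexive e).
Local Notation E := (edge_set e).
Local Notation phi := (phi_adj e).
Implicit Types s : prune_state T.

(** A common form for both kinds of iteration. The last clause, that a component which is a clique
    is removed whole, serves the partial cube case. *)
Lemma prune_stepP s s' :
  s.1 \subset E -> prune_step e extract s s' ->
  exists K, [/\ K != set0, K \subset s.1, is_clique phi K,
                s' = (s.1 :\: K, K |: s.2)
              & exists2 C, C \in components phi s.1 &
                  is_clique phi C -> K = C].
Proof.
move=> + st; case: st => /= [H P C [cC _] clC _ | H P C K [cC _] nclC exK HE].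
  by have [C0 CH _] := componentP cC; exists C; split=> //; exists C.
have [_ CH _] := componentP cC.
have [K0 KC clK] := (extractP (subset_trans CH HE) nclC).2 K exK.
exists K; split=> //; first exact: subset_trans CH.
by exists C => // clC; rewrite clC in nclC.
Qed.

Lemma prune_progress s :
  s.1 \subset E -> s.1 != set0 -> exists s', prune_step e extract s s'.
Proof.
case: s => H P /= HE /(largest_component_exists phi)[C lC].
have [clC|nclC] := boolP (is_clique phi C).
  by exists (H :\: C, C |: P); apply: prune_clique.
have [_ CH _] := componentP lC.1.
have [[K exK] _] := extractP (subset_trans CH HE) nclC.
by exists (H :\: K, K |: P); apply: prune_extract exK.
Qed.

Lemma prune_Acc s :
  s.1 \subset E -> Acc (fun s' s => prune_step e extract s s') s.
Proof.
have [n] := ubnP #|s.1|.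
elim: n s => [|n IHn] s; first by rewrite ltn0.
move=> /ltnSE lesn sE.
constructor=> s' /(prune_stepP sE)[K [K0 KH _ -> _]].
have ltK : #|s.1 :\: K| < #|s.1|.
  by rewrite cardsDS // ltn_subrL !card_gt0 K0 (subset_neq0 KH).
apply: (IHn (s.1 :\: K, K |: s.2)); first exact: leq_trans ltK lesn.
exact: subset_trans (subsetDl _ _) sE.
Qed.

Lemma prune_reachable_ind (I : prune_state T -> Prop) :
    I (prune_init e) ->
    (forall s s', I s -> prune_step e extract s s' -> I s') ->
  forall s, prune_reachable e extract s -> I s.
Proof.
move=> I0 IS s reach.
(* Transitivity is a constructor of [clos_refl_trans], so the induction needs an arbitrary starting
   state. *)
suff : forall a b,
    Relation_Operators.clos_refl_trans _ (prune_step e extract) a b -> I a -> I b.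
  by move/(_ _ _ reach I0).
move=> a b; elim=> {a b} [a b st Ia|//|a b c _ IHab _ IHbc /IHab//].
exact: IS st.
Qed.

Definition prune_invariant (s : prune_state T) : Prop :=
  [/\ s.1 \subset E, partition s.2 (E :\: s.1) &
      {in s.2, forall C, is_clique phi C}].

Lemma prune_reachable_invariant s :
  prune_reachable e extract s -> prune_invariant s.
Proof.
apply: prune_reachable_ind => [|{}s s' [sE partP clP] st].
  split=> //= [|C]; last by rewrite inE.
  rewrite setDv; apply/and3P; split; rewrite ?inE //.
    by rewrite /cover big_set0.
  by apply/trivIsetP => A B; rewrite inE.
have [K [K0 KH clK -> _]] := prune_stepP sE st.
split=> /=.
- exact: subset_trans (subsetDl _ _) sE.
- exact: partition_setU1.
- by move=> C /setU1P[->|/clP].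
Qed.

(** Only whole theta-classes have been removed, so [H] is a union of theta-classes, and a component
    of it is the set of all edges of one direction. *)
Lemma partial_cube_component H P C :
    partial_cube e -> partition P (E :\: H) -> H \subset E ->
    P \subset theta_classes e -> C \in components phi H ->
  C \in theta_classes e /\ is_clique phi C.
Proof.
move=> /(partial_cube_direction e_sym e_irr)[D [dir [phiE thetaE]]].
move=> partP HE Pth /componentP[_ _ [A AH CE]].
have inE' B : B \in H -> B \in E by apply: (subsetP HE).
(* Were [B] already removed, its class, a full theta-class, would also contain [A], which is still
   in [H]. *)
have closedH B : B \in E -> dir A = dir B -> B \in H.
  move=> BE dAB; apply: contraT => BH.
  have : B \in cover P by rewrite (cover_partition partP) inE BH.
  case/bigcupP => X PX BX.
  have /imsetP[Z ZE XE] := subsetP Pth _ PX.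
  have AX : A \in X.
    move: BX; rewrite XE [B \in _]in_set [A \in _]in_set.
    have AE := inE' _ AH.
    by rewrite AE !thetaE // dAB => /andP[].
  have : A \in cover P by apply/bigcupP; exists X.
  by rewrite (cover_partition partP) inE AH.
(* Consecutive edges on a path of the phi-graph have the same direction. *)
have connE B : connect (induced phi H) A B -> dir A = dir B.
  case/connectP => p pth ->; elim: p A {AH CE closedH} pth => //= B' p IHp A.
  case/andP=> /and3P[AH BH /andP[_]].
  by rewrite phiE ?inE' // => /eqP -> /IHp.
have memC B : (B \in C) = (B \in E) && (dir A == dir B).
  rewrite CE inE; apply/andP/andP => [[BH /connE ->]|[BE /eqP dAB]].
    by rewrite eqxx inE'.
  have BH := closedH _ BE dAB; split=> //.
  have [->|AB] := eqVneq A B; first exact: connect0.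
  apply: connect1; apply/and3P; split=> //; apply/andP; split=> //.
  by rewrite phiE ?inE' // dAB.
split.
  apply/imsetP; exists A; first exact: inE'.
  apply/setP => B; rewrite memC [RHS]in_set; apply: andb_id2l => BE.
  by rewrite thetaE // inE'.
apply/forall_inP => B1; rewrite memC => /andP[E1 /eqP d1].
apply/forall_inP => B2; rewrite memC => /andP[E2 /eqP d2].
by apply/implyP => B12; apply/andP; rewrite phiE // -d1 -d2.
Qed.

Lemma partial_cube_prune_classes s :
    partial_cube e -> prune_reachable e extract s ->
  s.2 \subset theta_classes e.
Proof.
move=> pc reach.
(* The two facts are carried together because [partial_cube_component] needs the partition of the
   removed edges. *)
suff [] : prune_invariant s /\ s.2 \subset theta_classes e by [].
move: s reach; apply: prune_reachable_ind => [|s s' [inv sth] st].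
  split; last exact: sub0set.
  exact/prune_reachable_invariant/Relation_Operators.rt_refl.
have [sE partP clP] := inv.
have [K [K0 KH clK -> [C cC KC]]] := prune_stepP sE st.
have [Cth clC] := partial_cube_component pc partP sE sth cC.
rewrite (KC clC) in K0 KH clK *; split; last first.
  by rewrite subUset sub1set Cth.
split=> /=.
- exact: subset_trans (subsetDl _ _) sE.
- exact: partition_setU1.
- by move=> C' /setU1P[->|/clP].
Qed.

Lemma partial_cube_theta_partition :
  partial_cube e -> partition (theta_classes e) E.
Proof.
move=> /(partial_cube_direction e_sym e_irr)[D [dir [_ thetaE]]].
apply: equivalence_partitionP => A B C AE BE CE.
by rewrite !thetaE // eqxx; split=> // /eqP ->.
Qed.

End Prune.

Theorem theorem2p17 (T : finType) (e : rel T)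
    (e_sym : symmetric e) (e_irr : irreflexive e)
    (e_conn : forall x y : T, connect e x y)
    (extract : {set {set T}} -> {set {set T}} -> Prop)
    (extractP : clique_search e extract) :
  prune_terminates e extract /\
  (forall P : {set {set {set T}}}, prune_output e extract P ->
     [/\ partition P (edge_set e),
         {in P, forall C : {set {set T}}, is_clique (phi_adj e) C},
         {in P, forall C : {set {set T}}, is_matching e C},
         partial_cube e -> P = theta_classes e
       & #|P| <= #|edge_set e|]).
Proof.
split=> [|P outP].
  split; first by apply: prune_Acc => //=.
  move=> s /(prune_reachable_invariant extractP)[sE _ _].
  exact: prune_progress.
have [_ /= partP clP] := prune_reachable_invariant extractP outP.
(* No vertex remains in the final state, so the removed edges are all the edges. *)
rewrite setD0 in partP; split=> //.
- move=> C PC; apply: clique_matching; last exact: clP.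
  by rewrite -(cover_partition partP) (bigcup_max C).
(* Both families partition the edge set, so it suffices that every output class is a theta-class. *)
- move=> pc; apply: (partition_sub_eq partP).
    exact: partial_cube_theta_partition.
  exact: (partial_cube_prune_classes extractP e_sym e_irr pc outP).
- exact: card_partition_le.
Qed.
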